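(* If a finite simplicial complex $K$ collapses to a subcomplex $L$, then there is a $1$-collapse from the barycentric subdivision $K'$ to the barycentric subdivision $L'$. In particular, if $K$ is collapsible, then $K'$ is $1$-collapsible.
   Context: All simplicial complexes are finite (simplices are nonempty finite sets of vertices). If $\sigma$ is a free face of $\tau$ in $K$ (i.e. $\tau$ is the unique simplex of $K$ having $\sigma$ as a proper face), there is an elementary collapse from $K$ to the subcomplex $K\smallsetminus\{\sigma,\tau\}$. $K$ collapses to a subcomplex $L$ if there is a finite (possibly empty) sequence of elementary collapses from $K$ to $L$; $K$ is collapsible if it collapses to a point. For a vertex $v$ of a complex $K$, the link $\mathrm{lk}_K(v)$ is the subcomplex of simplices $\tau\in K$ with $v\notin\tau$ and $\tau\cup\{v\}\in K$, and $K\smallsetminus v$ is the full subcomplex of $K$ spanned by the vertices different from $v$. A simplicial cone is a complex $aM$, the join of a (possibly empty) complex $M$ and a vertex $a$ not in $M$; its simplices are $\{a\}$, the simplices $\tau$ of $M$, and the sets $\{a\}\cup\tau$ with $\tau\in M$. An elementary strong collapse from $K$ to $K\smallsetminus v$ exists when $\mathrm{lk}_K(v)$ is a simplicial cone. $K$ is $0$-collapsible (equivalently, strong collapsible) if there is a finite (possibly empty) sequence of elementary strong collapses from $K$ to one of its vertices. There is a $1$-collapse from $K$ to a subcomplex $L$ if $L$ is obtained from $K$ by deleting vertices one by one (replacing the current complex $M$ by $M\smallsetminus v$) in such a way that at each step the link of the deleted vertex in the current complex is $0$-collapsible. $K$ is $1$-collapsible if it $1$-collapses to a point. The barycentric subdivision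 $K'$ of $K$ has one vertex $\hat\sigma$ for each simplex $\sigma$ of $K$, and its simplices are the sets $\{\hat\sigma_0,\ldots,\hat\sigma_r\}$ corresponding to chains $\sigma_0\subseteq\sigma_1\subseteq\cdots\subseteq\sigma_r$ of simplices of $K$. *)

(* Defs.v *)
From mathcomp Require Import all_boot.

Set Implicit Arguments.
Unset Strict Implicit.
Unset Printing Implicit Defensive.

(** A finite simplicial complex on vertices taken from a finite type [V] is its
    set of (nonempty) simplices.  A vertex of [K] is a [v] with [[set v] \in K];
    elements of [V] need not be vertices of [K], and [K] may be empty. *)

Section Complexes.
Variable V : finType.
Implicit Types (K L M N : {set {set V}}) (s t r : {set V}) (v a : V).

Definition is_complex K : bool :=
  (set0 \notin K) &&
  [forall t in K, forall s : {set V}, (s != set0) && (s \subset t) ==> (s \in K)].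

Definition point v : {set {set V}} := [set [set v]].

Definition free_face K s t : bool :=
  [&& s \in K, t \in K, s \proper t &
      [forall r in K, (s \proper r) ==> (r == t)]].

Definition elem_collapse : rel {set {set V}} := fun K L =>
  [exists s, exists t, free_face K s t && (L == K :\: [set s; t])].

(** [connect e] is the reflexive transitive closure of [e], i.e. the existence
    of a finite, possibly empty, sequence of [e]-steps. *)
Definition collapses : rel {set {set V}} := connect elem_collapse.

Definition collapsible K : bool := [exists v, collapses K (point v)].

Definition link K v : {set {set V}} :=
  [set t in K | (v \notin t) && (v |: t \in K)].

Definition del_vertex K v : {set {set V}} := [set t in K | v \notin t].

Definition cone a M : {set {set V}} :=
  [set a] |: (M :|: [set a |: t | t in M]).

(** The base [M] may be empty, in which case the cone is a point. *)
Definition is_cone K : bool :=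
  [exists a, exists M, [&& is_complex M, [set a] \notin M & K == cone a M]].

Definition elem_strong_collapse : rel {set {set V}} := fun K L =>
  [exists v, [&& [set v] \in K, is_cone (link K v) & L == del_vertex K v]].

Definition zero_collapsible K : bool :=
  [exists v, ([set v] \in K) && connect elem_strong_collapse K (point v)].

Definition elem_one_collapse : rel {set {set V}} := fun K L =>
  [exists v,
    [&& [set v] \in K, zero_collapsible (link K v) & L == del_vertex K v]].

Definition one_collapses : rel {set {set V}} := connect elem_one_collapse.

Definition one_collapsible K : bool := [exists v, one_collapses K (point v)].

(** The vertex of the subdivision associated with a simplex [s] of [K] is [s]
    itself, so the subdivision is a complex on the finite type [{set V}]; its
    simplices are the nonempty subsets of [K] totally ordered by inclusion. *)
Definition barycentric K : {set {set {set V}}} :=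
  [set c : {set {set V}} |
    [&& c != set0, c \subset K &
        [forall s in c, forall t in c, (s \subset t) || (t \subset s)]]].

End Complexes.

(* Main.v *)
(** Write [D(P)] for the order complex of a family [P] of sets, so that
    [barycentric K = D(K)].  Deleting a vertex [v] of [D(P)] gives [D(P - v)],
    and the link of [v] is [D(Q)] for [Q] the members of [P - v] comparable with
    [v]; so the whole argument takes place among families of sets.  If a member
    of [P] is comparable with all the others then [D(P)] is a cone, hence strong
    collapsible.

    An elementary collapse removes a free face [s] of [t = a |: s].  In [D(K)]
    the link of [s] is a cone with apex [t].  After the deletion of [s], the link
    of [t] is [D(Q)], [Q] being the proper faces of [t] other than [s].  As [Q]
    contains [{a}] and is stable under [r |-> a |: r], one can delete the members
    of [Q] avoiding [a], largest first: the link of [r] is then a cone with apex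
    [a |: r].  What remains is a cone with apex [{a}]. *)
Require Import Defs.
From mathcomp Require Import all_boot.

Set Implicit Arguments.
Unset Strict Implicit.
Unset Printing Implicit Defensive.

Section OrderComplexes.
Variable V : finType.
Implicit Types (K P : {set {set V}}) (s t r : {set V}).

Definition comparable_in P s : {set {set V}} :=
  [set r in P :\ s | (r \subset s) || (s \subset r)].

Lemma barycentricP P (c : {set {set V}}) :
  reflect [/\ c != set0, c \subset P &
              {in c &, forall s t, (s \subset t) || (t \subset s)}]
          (c \in barycentric P).
Proof.
rewrite inE; apply: (iffP and3P) => [[c0 cP /forall_inP ch]|[c0 cP ch]].
  by split=> // s t sc tc; have /forall_inP := ch s sc; apply.
by split=> //; apply/forall_inP => s sc; apply/forall_inP => t tc; apply: ch.
Qed.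

Lemma barycentric_complex P : is_complex (barycentric P).
Proof.
apply/andP; split; first by apply/barycentricP => -[]; rewrite eqxx.
apply/forall_inP => c /barycentricP[_ cP ch]; apply/forallP => d.
apply/implyP => /andP[d0 /subsetP dc]; apply/barycentricP; split=> //.
  by apply/subsetP => s /dc; apply: (subsetP cP).
by move=> s t /dc sc /dc tc; apply: ch.
Qed.

Lemma vertex_barycentric P s : ([set s] \in barycentric P) = (s \in P).
Proof.
apply/barycentricP/idP => [[_ + _]|sP]; first by rewrite sub1set.
split; first by apply/set0Pn; exists s; rewrite set11.
  by rewrite sub1set.
by move=> x y /set1P-> /set1P->; rewrite subxx.
Qed.

Lemma barycentric_set1 s : barycentric [set s] = point s.
Proof.
apply/setP => c; rewrite in_set1; apply/idP/eqP => [|->].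
  by move=> /barycentricP[c0]; rewrite subset1 (negPf c0) orbF => /eqP.
by rewrite vertex_barycentric set11.
Qed.

Lemma del_vertex_barycentric P s :
  del_vertex (barycentric P) s = barycentric (P :\ s).
Proof.
apply/setP => c; rewrite inE.
apply/andP/barycentricP => [[/barycentricP[c0 cP ch] sc]|[c0]].
  by split=> //; rewrite subsetD1 cP.
by rewrite subsetD1 => /andP[cP sc] ch; split=> //; apply/barycentricP.
Qed.

(** The disjunct [c == set0] covers the vertex [s] alone, the empty set being no simplex. This
    equivalence serves both to compute the link of [s] and to recognise cones with apex [s]. *)
Lemma barycentric_add P s (c : {set {set V}}) :
  s \in P -> s \notin c ->
  (s |: c \in barycentric P) =
  (c == set0) || (c \in barycentric (comparable_in P s)).
Proof.
move=> sP sc; apply/barycentricP/orP => [[_ cP ch]|cQ].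
  have [->|c0] := eqVneq c set0; [by left | right].
  apply/barycentricP; split=> // [|x y xc yc]; last first.
    by apply: ch; rewrite setU1r.
  apply/subsetP => x xc; have xs : x != s by apply: contraNneq sc => <-.
  by rewrite !inE xs (subsetP cP) ?setU1r // ch ?setU11 ?setU1r.
have cQ' : {in c, forall x, x \in comparable_in P s}.
  case: cQ => [/eqP-> x|/barycentricP[_ /subsetP cQ _] x /cQ //].
  by rewrite inE.
split; first by apply/set0Pn; exists s; rewrite setU11.
  apply/subsetP => x /setU1P[->//|/cQ'].
  by rewrite !inE => /andP[/andP[]].
move=> x y /setU1P[->|xc] /setU1P[->|yc]; first by rewrite subxx.
- by move/cQ': yc; rewrite inE orbC => /andP[].
- by move/cQ': xc; rewrite inE => /andP[].
case: cQ => [/eqP c0|/barycentricP[_ _]]; first by rewrite c0 inE in xc.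
exact.
Qed.

Lemma link_barycentric P s : s \in P ->
  link (barycentric P) s = barycentric (comparable_in P s).
Proof.
move=> sP; apply/setP => c; rewrite inE.
apply/and3P/idP => [[cP sc]|cQ].
  rewrite barycentric_add // => /orP[/eqP c0|//].
  by move/barycentricP: cP => []; rewrite c0 eqxx.
have /barycentricP[c0 /subsetP cQs ch] := cQ.
have sc : s \notin c by apply/negP => /cQs; rewrite !inE eqxx.
split=> //; last by rewrite barycentric_add // cQ orbT.
apply/barycentricP; split=> //.
by apply/subsetP => x /cQs; rewrite !inE => /andP[/andP[]].
Qed.

(** The vertices of the link of [s] are all of [P :\ s], so the base is [barycentric (P :\ s)],
    empty when [P] is [[set s]]. *)
Lemma barycentric_is_cone P s : s \in P ->
  {in P, forall r : {set V}, (r \subset s) || (s \subset r)} -> is_cone (barycentric P).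
Proof.
move=> sP sch; apply/existsP; exists s; apply/existsP.
have Qs : comparable_in P s = P :\ s.
  apply/setP => r; rewrite inE; case: (boolP (r \in P :\ s)) => //=.
  by case/setD1P => _ /sch.
exists (barycentric (P :\ s)); apply/and3P; split.
- exact: barycentric_complex.
- by rewrite vertex_barycentric !inE eqxx.
apply/eqP/setP => c; apply/idP/idP.
  move=> cP; apply/setU1P; case: (boolP (s \in c)) => sc; last first.
    by right; apply/setUP; left; rewrite -del_vertex_barycentric inE cP.
  have := @barycentric_add _ _ (c :\ s) sP; rewrite setD11 setD1K // => /(_ isT).
  rewrite cP Qs => /esym/orP[/eqP c0|cQ]; [left | right].
    by rewrite -(setD1K sc) c0 setU0.
  by apply/setUP; right; apply/imsetP; exists (c :\ s); rewrite ?setD1K.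
case/setU1P => [->|/setUP[|/imsetP[d dQ ->]]].
- by rewrite vertex_barycentric.
- by rewrite -del_vertex_barycentric inE => /andP[].
have sd : s \notin d.
  by move: dQ; rewrite -del_vertex_barycentric inE => /andP[].
by rewrite barycentric_add // Qs dQ orbT.
Qed.

Lemma elem_strong_collapse_barycentric P s r :
  s \in P -> r \in comparable_in P s ->
  {in comparable_in P s, forall q : {set V}, (q \subset r) || (r \subset q)} ->
  elem_strong_collapse (barycentric P) (barycentric (P :\ s)).
Proof.
move=> sP rQ rch; apply/existsP; exists s; apply/and3P; split.
- by rewrite vertex_barycentric.
- by rewrite link_barycentric //; apply: barycentric_is_cone rch.
by rewrite del_vertex_barycentric.
Qed.

(** Any member [r] other than [s] may be deleted first: [s] makes its link a cone, and [s] stays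
    comparable with all that remains. *)
Lemma cone_strong_collapse P s : s \in P ->
  {in P, forall r : {set V}, (r \subset s) || (s \subset r)} ->
  connect (@elem_strong_collapse _) (barycentric P) (point s).
Proof.
elim: {P}#|P| {-2}P (leqnn #|P|) => [|n IHn] P.
  by rewrite leqn0 cards_eq0 => /eqP->; rewrite inE.
move=> Pn sP sch; have [P1|] := eqVneq (P :\ s) set0.
  by rewrite -(setD1K sP) P1 setU0 barycentric_set1 connect0.
case/set0Pn => r /setD1P[rs rP].
apply: (@connect_trans _ _ (barycentric (P :\ r))).
  apply/connect1/(@elem_strong_collapse_barycentric _ _ s) => //.
    by rewrite !inE eq_sym rs sP orbC sch.
  by move=> q; rewrite !inE => /andP[/andP[_ qP] _]; apply: sch.
apply: IHn => [|| q /setD1P[_ qP]]; last exact: sch.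
  by rewrite -ltnS (leq_trans _ Pn) // [#|P|](cardsD1 r) rP.
by rewrite !inE eq_sym rs.
Qed.

Lemma strong_collapse_of_join_closed P a : [set a] \in P ->
  {in P, forall r : {set V}, a |: r \in P} ->
  connect (@elem_strong_collapse _) (barycentric P) (point [set a]).
Proof.
elim: {P}#|P| {-2}P (leqnn #|P|) => [|n IHn] P.
  by rewrite leqn0 cards_eq0 => /eqP->; rewrite inE.
move=> Pn aP cl; case: (set_0Vmem [set r in P | a \notin r]) => [P0|[r0 r0P]].
  apply: cone_strong_collapse => // r rP; apply/orP; right.
  rewrite sub1set; apply/negPn/negP => ar.
  by move/setP/(_ r): P0; rewrite !inE rP ar.
rewrite inE in r0P.
(* By maximality of [#|r|], a member of [P] properly containing [r] contains [a], hence [a |: r]; a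
   member inside [r] lies in [a |: r]. *)
have [r /andP[rP ar] rmax] :=
  @arg_maxnP _ r0 (fun r => (r \in P) && (a \notin r)) (fun r => #|r|) r0P.
have neq_r (q : {set V}) : a \in q -> q != r by move=> aq; apply: contraNneq ar => <-.
apply: (@connect_trans _ _ (barycentric (P :\ r))).
  apply/connect1/(@elem_strong_collapse_barycentric _ _ (a |: r)) => //.
    by rewrite !inE neq_r ?setU11 // cl // subsetUr orbT.
  move=> q; rewrite !inE => /andP[/andP[qr qP] /orP[qsr|rsq]].
    by rewrite (subset_trans qsr) ?subsetUr.
  rewrite orbC subUset sub1set rsq andbT; apply/orP; left.
  apply/negPn/negP => aq; have /rmax qler : (q \in P) && (a \notin q).
    by rewrite qP.
  by move: qr; rewrite eq_sym eqEcard rsq [_ <= _]qler.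
(* Closure under adding [a] survives because [r] avoids [a], so no set [a |: q] is lost. *)
apply: IHn => [|| q /setD1P[_ qP]].
- by rewrite -ltnS (leq_trans _ Pn) // [#|P|](cardsD1 r) rP.
- by rewrite in_setD1 neq_r ?set11.
by rewrite in_setD1 neq_r ?setU11 ?cl.
Qed.

Lemma elem_one_collapse_barycentric P s x : s \in P -> x \in comparable_in P s ->
  connect (@elem_strong_collapse _)
    (barycentric (comparable_in P s)) (point x) ->
  elem_one_collapse (barycentric P) (barycentric (P :\ s)).
Proof.
move=> sP xQ sc; apply/existsP; exists s.
rewrite vertex_barycentric sP link_barycentric // del_vertex_barycentric eqxx andbT.
by apply/existsP; exists x; rewrite vertex_barycentric xQ.
Qed.

Lemma is_complexP K : reflect
  (set0 \notin K /\
   forall s t, t \in K -> s != set0 -> s \subset t -> s \in K)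
  (is_complex K).
Proof.
apply: (iffP andP) => [[K0 /forall_inP Kc]|[K0 Kc]]; split=> //.
  by move=> s t /Kc/forallP/(_ s)/implyP sK s0 st; rewrite sK ?s0.
apply/forall_inP => t tK; apply/forallP => s; apply/implyP => /andP[s0 st].
exact: Kc tK s0 st.
Qed.

Lemma free_face_max K s t : free_face K s t ->
  {in K, forall r, s \proper r -> r = t}.
Proof.
by case/and4P => _ _ _ /forall_inP smax r /smax/implyP rt /rt/eqP.
Qed.

(** A remaining simplex with [s] or [t] as a face would properly contain [s], hence be [t] by
    freeness. This lets collapses be iterated. *)
Lemma elem_collapse_complex K L :
  is_complex K -> elem_collapse K L -> is_complex L.
Proof.
move=> /is_complexP[K0 Kc] /existsP[s /existsP[t /andP[sft /eqP->]]].
have smax := free_face_max sft; have [_ _ st _] := and4P sft.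
apply/is_complexP; split=> [|x y]; first by rewrite inE (negPf K0) andbF.
rewrite !inE !negb_or => /andP[/andP[ys yt] yK] x0 xy.
rewrite (Kc _ _ yK x0 xy) andbT; apply/andP; split.
  apply: contraNneq yt => xs; apply/eqP/smax => //.
  by rewrite properEneq eq_sym ys -xs.
apply: contraNneq yt => xt; apply/eqP/smax => //.
by apply: proper_sub_trans st _; rewrite -xt.
Qed.

Lemma elem_collapse_barycentric K L : is_complex K -> elem_collapse K L ->
  one_collapses (barycentric K) (barycentric L).
Proof.
move=> /is_complexP[K0 Kc] /existsP[s /existsP[t /andP[sft /eqP->]]].
have smax := free_face_max sft; have [sK tK st _] := and4P sft.
have [sst [a at_ as_]] := properP st.
have s0 : s != set0 by apply: contraNneq K0 => <-.
have nst : s != t by move: st; rewrite properEneq => /andP[].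
(* The set [a |: s] is a face of [t] properly containing [s], so freeness forces it to be [t]. *)
have tE : t = a |: s.
  apply/esym/smax; last first.
    by rewrite properEneq subsetUr andbT; apply: contraNneq as_ => ->; rewrite setU11.
  apply: (Kc _ t) => //; first by apply/set0Pn; exists a; rewrite setU11.
  by rewrite subUset sub1set at_.
rewrite (_ : K :\: [set s; t] = K :\ s :\ t); last by rewrite setDDl.
apply: (@connect_trans _ _ (barycentric (K :\ s))).
  apply/connect1/(@elem_one_collapse_barycentric _ _ t) => //.
    by rewrite !inE eq_sym nst tK sst orbT.
  apply: cone_strong_collapse => [|r].
    by rewrite !inE eq_sym nst tK sst orbT.
  rewrite !inE => /andP[/andP[rs rK] /orP[rsub|sr]].
    by rewrite (subset_trans rsub).
  by rewrite (smax r) ?subxx // properEneq eq_sym rs.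
have tK' : t \in K :\ s by rewrite !inE eq_sym nst.
(* No simplex lies properly above [t]: it would also lie properly above [s]. So only faces of [t]
   occur here. *)
have memQ r : (r \in comparable_in (K :\ s) t) =
              [&& r != set0, r != s, r != t & r \subset t].
  rewrite !inE; apply/idP/idP => [/andP[/and3P[rt rs rK] rc]|].
    rewrite rt rs (contraNneq _ K0) => [|<-] //=.
    case/orP: rc => // tr; case/eqP: rt; apply: smax => //.
    exact: proper_sub_trans st tr.
  by case/and4P => r0 -> -> rt; rewrite (Kc _ t) // rt.
have aQ : [set a] \in comparable_in (K :\ s) t.
  rewrite memQ sub1set at_ andbT; apply/and3P; split.
  - by apply/set0Pn; exists a; rewrite set11.
  - by apply: contraNneq as_ => <-; rewrite set11.
  (* If [t] were [[set a]], its nonempty face [s] would be [[set a]] too, although [s] avoids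
     [a]. *)
  apply: contraNneq s0 => at1; move: sst; rewrite -at1 subset1.
  by case/orP => // /eqP sa; rewrite sa set11 in as_.
apply/connect1/(@elem_one_collapse_barycentric _ _ [set a]) => //.
apply: strong_collapse_of_join_closed => // r.
rewrite !memQ => /and4P[r0 rs rt rsub]; apply/and4P; split.
- by apply/set0Pn; exists a; rewrite setU11.
- by apply: contraNneq as_ => <-; rewrite setU11.
(* If [a |: r] were [t], then [r] would be [t] when it contains [a], and [s] otherwise; both are
   excluded. *)
- apply/eqP => art; case: (boolP (a \in r)) => ar.
    by case/eqP: rt; rewrite -art (setUidPr _) // sub1set.
  by case/eqP: rs; rewrite -(setU1K ar) art tE setU1K.
by rewrite subUset sub1set at_.
Qed.

Lemma collapses_barycentric K L : is_complex K -> collapses K L ->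
  one_collapses (barycentric K) (barycentric L).
Proof.
move=> Kc /connectP[p]; elim: p K Kc => [|M p IHp] K Kc /= => [_ ->|].
  exact: connect0.
case/andP => KM pM Lp; apply: connect_trans (elem_collapse_barycentric Kc KM) _.
exact: IHp (elem_collapse_complex Kc KM) pM Lp.
Qed.

End OrderComplexes.

Theorem corollary5p11 (V : finType) (K : {set {set V}}) (hK : is_complex K) :
  (forall L : {set {set V}}, is_complex L -> L \subset K ->
     collapses K L -> one_collapses (barycentric K) (barycentric L))
  /\ (collapsible K -> one_collapsible (barycentric K)).
Proof.
split=> [L _ _|/existsP[v Kv]]; first exact: collapses_barycentric.
apply/existsP; exists [set v].
(* [point v] unfolds to [[set [set v]]], so its subdivision is the point [[set v]]. *)
rewrite -barycentric_set1; exact: collapses_barycentric.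
Qed.
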